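(* For any real $\alpha>\frac{\log(3)}{\log(4)}$, one has $$\lim_{N\to\infty}\frac{1}{N^{\alpha}}\sum_{m=0}^{N-1}|\eta(m)|=0.$$
   Context: The Thue--Morse sequence $(t_k)_{k\geqslant 0}$ with values $\pm1$ is defined by $t_0=1$, $t_{2k}=t_k$, $t_{2k+1}=-t_k$ for $k\geqslant 0$. Its balanced two-point correlation (autocorrelation) coefficients are $\eta(m)=\lim_{N\to\infty}\frac1N\sum_{k=0}^{N-1}t_kt_{k+m}$ for $m\in\mathbb{N}_0$ (the limit is known to exist). It is well known that $\eta(0)=1$, $\eta(2m)=\eta(m)$ and $\eta(2m+1)=-\frac12\bigl(\eta(m)+\eta(m+1)\bigr)$ for $m\geqslant 0$, which determines $\eta$ on $\mathbb{N}_0$. *)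

(* Defs.v *)
From HB Require Import structures.
From mathcomp Require Import all_boot all_order all_algebra.
From mathcomp Require Import all_classical all_reals all_analysis.

Set Implicit Arguments.
Unset Strict Implicit.
Unset Printing Implicit Defensive.

Import Order.TTheory GRing.Theory Num.Theory.
Import numFieldNormedType.Exports.

Local Open Scope classical_set_scope.
Local Open Scope ring_scope.

(* [xO q], [xI q] and [xH] denote 2q, 2q+1 and 1, so the three branches are    *)
(* t_{2q} = t_q, t_{2q+1} = - t_q and t_1 = - t_0 = -1.                        *)
Fixpoint thue_morse_pos (p : BinNums.positive) : int :=
  match p with
  | BinNums.xH => -1
  | BinNums.xO q => thue_morse_pos q
  | BinNums.xI q => - thue_morse_pos q
  end.

Definition thue_morse (k : nat) : int :=
  if bin_of_nat k is BinNums.Npos p then thue_morse_pos p else 1.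

Lemma thue_morse0 : thue_morse 0 = 1.
Proof. by []. Qed.

Lemma thue_morse_double (k : nat) : thue_morse (2 * k) = thue_morse k.
Proof.
rewrite /thue_morse -{1}(bin_of_natK k); case: (bin_of_nat k) => [|p] //=.
suff -> : bin_of_nat (2 * nat_of_pos p) = BinNums.Npos (BinNums.xO p) by [].
by rewrite -[RHS]nat_of_binK /= NatTrec.doubleE mul2n.
Qed.

Lemma thue_morse_doubleS (k : nat) : thue_morse (2 * k).+1 = - thue_morse k.
Proof.
rewrite /thue_morse -{1}(bin_of_natK k); case: (bin_of_nat k) => [|p] //.
suff -> : (2 * BinNums.Npos p).+1 = BinNums.Npos (BinNums.xI p) :> nat.
  by rewrite nat_of_binK.
by rewrite /= NatTrec.doubleE mul2n.
Qed.

(* [lim] is total and returns an arbitrary value when the limit does not      *)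
(* exist; here the limit does exist for every [m].                            *)
Definition eta (R : realType) (m : nat) : R :=
  lim ((N%:R^-1 * \sum_(0 <= k < N) (thue_morse k * thue_morse (k + m))%:~R : R)
       @[N --> \oo]).

(* Main.v *)
(** The recursion for [eta] gives, with [a = eta m] and [b = eta (m+1)],
    [eta (4m) = a], [eta (4m+2) = -(a+b)/2] and [eta (4m+1) = -(a-b)/4],
    [eta (4m+3) = (a-b)/4].  Hence a block of four absolute values sums to
    [|a| + max(|a|,|b|) <= 2|a| + |b|], so the sum over [m < 4N] is at most
    three times the sum over [m < N], and the sums grow like
    [N^(ln 3 / ln 4)].

    The recursion requires the limits to exist.  Correlation sums at [2m] and
    [2m+1] of length [2N] are combinations of those at [m] and [m+1] of length
    [N], which settles everything by induction except the self-referential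
    shift [m = 1]. *)

Require Import Defs.
From mathcomp Require Import all_boot all_order all_algebra.
From mathcomp Require Import all_classical all_reals all_analysis.
From mathcomp Require Import zify ring lra.

Import Order.TTheory GRing.Theory Num.Theory.
Import numFieldNormedType.Exports.

Local Open Scope classical_set_scope.
Local Open Scope ring_scope.

(** * Finite correlation sums and their doubling rules *)

Lemma norm_thue_morse (k : nat) : `|thue_morse k| = 1.
Proof.
rewrite /thue_morse; case: (bin_of_nat k) => [|p] //.
by elim: p => [p IHp|p IHp|] //=; rewrite normrN.
Qed.

Lemma big_nat_double (V : nmodType) (F : nat -> V) (n : nat) :
  \sum_(0 <= k < 2 * n) F k = \sum_(0 <= k < n) (F (2 * k)%N + F (2 * k).+1).
Proof.
elim: n => [|n IHn]; first by rewrite muln0 !big_geq.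
by rewrite mulnS add2n !big_nat_recr //= IHn addrA.
Qed.

Definition corr (R : realType) (m N : nat) : R :=
  \sum_(0 <= k < N) (thue_morse k * thue_morse (k + m))%:~R.

Lemma corrS (R : realType) (m N : nat) : `|corr R m N.+1 - corr R m N| <= 1.
Proof.
rewrite /corr big_nat_recr //= addrAC subrr add0r.
by rewrite -intr_norm normrM !norm_thue_morse.
Qed.

Lemma corr0 (R : realType) (N : nat) : corr R 0 N = N%:R.
Proof.
rewrite /corr (eq_bigr (fun=> 1)) => [|k _].
  by rewrite sumr_const_nat subn0.
by rewrite addn0 -expr2 -real_normK ?num_real // norm_thue_morse.
Qed.

Lemma corr_double (R : realType) (m N : nat) :
  corr R (2 * m) (2 * N) = 2 * corr R m N.
Proof.
rewrite /corr big_nat_double mulr_sumr; apply: eq_bigr => k _.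
rewrite addSn -mulnDr !thue_morse_double !thue_morse_doubleS mulrNN.
by rewrite mulr_natl mulr2n.
Qed.

(** An odd shift takes [2k] to [2(k+m)+1] and [2k+1] to [2(k+m+1)], so exactly one factor changes
    sign in each product. *)
Lemma corr_doubleS (R : realType) (m N : nat) :
  corr R (2 * m).+1 (2 * N) = - (corr R m N + corr R m.+1 N).
Proof.
rewrite /corr big_nat_double -big_split -sumrN; apply: eq_bigr => k _ /=.
have -> : (2 * k + (2 * m).+1 = (2 * (k + m)).+1)%N by lia.
have -> : ((2 * k).+1 + (2 * m).+1 = 2 * (k + m.+1))%N by lia.
rewrite !thue_morse_double !thue_morse_doubleS mulrN mulNr.
by rewrite !rmorphN opprD.
Qed.

(** * Existence of the limits *)

(* [corr R m N = N a + o(N)], in a form with no exceptional small [N]. *)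
Definition is_corr_rate (R : realType) (m : nat) (a : R) :=
  forall e : R, 0 < e -> exists C : R,
    forall N : nat, `|corr R m N - N%:R * a| <= C + e * N%:R.

Lemma is_corr_rate_cvg (R : realType) (m : nat) (a : R) :
  is_corr_rate R m a -> N%:R^-1 * corr R m N @[N --> \oo] --> a.
Proof.
move=> ha; apply/cvgrPdist_le => e e0.
have [C hC] := ha (e / 2) (divr_gt0 e0 (ltr0Sn _ 1)).
near=> N.
have N0 : 0 < N%:R :> R by rewrite ltr0n; near: N; exact: nbhs_infty_gt.
(* From this [N] on, [C] is at most [(e / 2) N]. *)
have hN : 2 * C / e <= N%:R by near: N; exact: nbhs_infty_ger.
rewrite distrC -(ler_pM2l N0) -{1}(gtr0_norm N0) -normrM mulrBr mulrA.
rewrite divff ?gt_eqF // mul1r; apply: (le_trans (hC N)).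
by move: hN; rewrite ler_pdivrMr //; nra.
Unshelve. all: by end_near. Qed.

Lemma eta_rate (R : realType) (m : nat) (a : R) : is_corr_rate R m a -> eta R m = a.
Proof. by move=> /is_corr_rate_cvg ha; apply: cvg_lim. Qed.

(* Consecutive partial sums differ by at most 1, so even lengths suffice. *)
Lemma is_corr_rate_even (R : realType) (m : nat) (a : R) :
  (forall e : R, 0 < e -> exists C : R, forall N : nat,
     `|corr R m (2 * N) - (2 * N)%:R * a| <= C + e * (2 * N)%:R) ->
  is_corr_rate R m a.
Proof.
move=> ha e e0; have [C hC] := ha e e0.
(* From length [2M] to [2M+1] the sum moves by at most 1 and the target by [|a|]. *)
exists (C + 1 + `|a|) => N.
have [M [->|->]] : exists M, N = (2 * M)%N \/ N = (2 * M).+1.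
- by exists N./2; lia.
- by apply: (le_trans (hC M)); have := normr_ge0 a; lra.
have := hC M; have := corrS R m (2 * M).
rewrite -(natr1 (2 * M)).
set x := corr _ _ _; set y := corr _ _ _; set n := (2 * M)%:R => h1 h2.
have -> : x - (n + 1) * a = (x - y) + (y - n * a) - a by ring.
apply: (le_trans (ler_normB _ _)).
have := ler_normD (x - y) (y - n * a); lra.
Qed.

Lemma is_corr_rate_double (R : realType) (m : nat) (a : R) :
  is_corr_rate R m a -> is_corr_rate R (2 * m) a.
Proof.
move=> ha; apply: is_corr_rate_even => e e0.
have [C hC] := ha e e0; exists (2 * C) => N.
rewrite corr_double natrM -mulrA -mulrBr normrM normr_nat.
by have := hC N; lra.
Qed.

Lemma is_corr_rate_doubleS (R : realType) (m : nat) (a b : R) :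
  is_corr_rate R m a -> is_corr_rate R m.+1 b ->
  is_corr_rate R (2 * m).+1 (- ((a + b) / 2)).
Proof.
move=> ha hb; apply: is_corr_rate_even => e e0.
have [C hC] := ha e e0; have [D hD] := hb e e0; exists (C + D) => N.
rewrite corr_doubleS natrM.
set x := corr _ _ _; set y := corr _ _ _.
have -> : - (x + y) - 2%:R * N%:R * - ((a + b) / 2) =
  - ((x - N%:R * a) + (y - N%:R * b)) by field.
rewrite normrN; apply: (le_trans (ler_normD _ _)).
by have := hC N; have := hD N; rewrite -/x -/y; lra.
Qed.

Lemma is_corr_rate0 (R : realType) : is_corr_rate R 0 1.
Proof.
move=> e e0; exists 0 => N.
by rewrite corr0 mulr1 subrr normr0 add0r mulr_ge0 // ltW.
Qed.

(* The discrepancy d N = corr 1 N + N / 3 satisfies d (2N) = - d N, so |d|    *)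
(* grows by at most 4/3 each time N doubles.                                  *)
Lemma is_corr_rate1 (R : realType) : is_corr_rate R 1 (- 3^-1).
Proof.
(* The constant is [4/3] times the threshold [8/(3e)]: below it the trivial bound [4n/3] suffices;
   above it, [n = 2M+1] gives [e(M+1) > 4/3], which absorbs the odd step. *)
move=> e e0; exists (32 / 9 / e) => N.
rewrite mulrN opprK.
have step n : `|corr R 1 n.+1 + n.+1%:R / 3| <= `|corr R 1 n + n%:R / 3| + 4 / 3.
  have := corrS R 1 n; rewrite -(natr1 n).
  set x := corr _ _ _; set y := corr _ _ _ => h.
  have -> : x + (n%:R + 1) / 3 = (x - y) + (y + n%:R / 3) + 3^-1 by field.
  have := ler_normD (x - y + (y + n%:R / 3)) 3^-1.
  have := ler_normD (x - y) (y + n%:R / 3).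
  by rewrite [`|3^-1|]ger0_norm ?invr_ge0 //; lra.
have double n : `|corr R 1 (2 * n) + (2 * n)%:R / 3| = `|corr R 1 n + n%:R / 3|.
  rewrite (corr_doubleS R 0 n) corr0 natrM -normrN.
  by congr (`| _ |); field.
have triv n : `|corr R 1 n + n%:R / 3| <= 4 / 3 * n%:R.
  elim: n => [|n IHn].
    by rewrite /corr big_geq // mul0r addr0 normr0 mulr0.
  by apply: (le_trans (step n)); rewrite -(natr1 n); lra.
elim/ltn_ind: N => n IHn.
have C0 : 0 < 32 / 9 / e by rewrite !divr_gt0.
have [small|large] := lerP (e * n%:R) (8 / 3).
  apply: (le_trans (triv n)).
  have : n%:R <= 8 / 3 / e by rewrite ler_pdivlMr // mulrC.
  have : 0 <= e * n%:R by rewrite mulr_ge0 // ltW.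
  lra.
have n0 : (0 < n)%N by case: n large {IHn} => //; rewrite mulr0; lra.
have [M [En|En]] : exists M, n = (2 * M)%N \/ n = (2 * M).+1 by exists n./2; lia.
  rewrite En double; apply: (le_trans (IHn M _)); first lia.
  by rewrite lerD2l ler_pM2l // ler_nat; lia.
rewrite En; apply: (le_trans (step _)); rewrite double.
have := IHn M ltac:(lia).
move: large; rewrite En -(natr1 (2 * M)) natrM; nra.
Qed.

(** Any rate must equal [eta], so existence suffices. In the strong induction, [k+1 < 2k+1] fails
    only for [k = 0], hence the separate case of shift 1. *)
Lemma is_corr_rate_eta (R : realType) (m : nat) : is_corr_rate R m (eta R m).
Proof.
suff [a ha] : exists a, is_corr_rate R m a by rewrite (eta_rate R m a ha).
elim/ltn_ind: m => m IHm.
have [->|m0] := eqVneq m 0%N; first by exists 1; exact: is_corr_rate0.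
have [->|m1] := eqVneq m 1%N; first by exists (- 3^-1); exact: is_corr_rate1.
have [k [Em|Em]] : exists k, m = (2 * k)%N \/ m = (2 * k).+1 by exists m./2; lia.
  have [a ha] := IHm k ltac:(lia); exists a; rewrite Em.
  exact: is_corr_rate_double.
have [a ha] := IHm k ltac:(lia); have [b hb] := IHm k.+1 ltac:(lia).
by exists (- ((a + b) / 2)); rewrite Em; exact: is_corr_rate_doubleS.
Qed.

(** * Recursion and bounds for [eta] *)

Lemma eta0 (R : realType) : eta R 0 = 1.
Proof. exact: eta_rate (is_corr_rate0 R). Qed.

Lemma eta1 (R : realType) : eta R 1 = - 3^-1.
Proof. exact: eta_rate (is_corr_rate1 R). Qed.

Lemma eta_double (R : realType) (m : nat) : eta R (2 * m) = eta R m.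
Proof. apply: eta_rate; apply: is_corr_rate_double; exact: is_corr_rate_eta. Qed.

Lemma eta_doubleS (R : realType) (m : nat) :
  eta R (2 * m).+1 = - ((eta R m + eta R m.+1) / 2).
Proof.
by apply: eta_rate; apply: is_corr_rate_doubleS; exact: is_corr_rate_eta.
Qed.

Lemma norm_eta_le1 (R : realType) (m : nat) : `|eta R m| <= 1.
Proof.
elim/ltn_ind: m => m IHm.
have [->|m0] := eqVneq m 0%N; first by rewrite eta0 normr1.
have [->|m1] := eqVneq m 1%N.
  by rewrite eta1 normrN ger0_norm ?invr_ge0 // invf_le1 // ler1n.
have [k [Em|Em]] : exists k, m = (2 * k)%N \/ m = (2 * k).+1 by exists m./2; lia.
  by rewrite Em eta_double; apply: IHm; lia.
rewrite Em eta_doubleS normrN normrM [`|2^-1|]ger0_norm ?invr_ge0 //.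
have := IHm k ltac:(lia); have := IHm k.+1 ltac:(lia).
have := ler_normD (eta R k) (eta R k.+1); lra.
Qed.

Lemma norm_eta_block (R : realType) (m : nat) :
  `|eta R (4 * m)| + `|eta R (4 * m).+1| + `|eta R (4 * m).+2|
    + `|eta R (4 * m).+3| <= 2 * `|eta R m| + `|eta R m.+1|.
Proof.
have -> : (4 * m = 2 * (2 * m))%N by lia.
have -> : ((2 * (2 * m)).+3 = (2 * (2 * m).+1).+1)%N by lia.
have -> : ((2 * (2 * m)).+2 = 2 * (2 * m).+1)%N by lia.
rewrite !eta_doubleS !eta_double !eta_doubleS.
have -> : ((2 * m).+2 = 2 * m.+1)%N by lia.
rewrite eta_double; set a := eta R m; set b := eta R m.+1.
have -> : - ((a + - ((a + b) / 2)) / 2) = - ((a - b) / 4) by field.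
have -> : - ((- ((a + b) / 2) + b) / 2) = (a - b) / 4 by field.
rewrite !normrN !normrM ![`|_^-1|]ger0_norm ?invr_ge0 //.
(* The last three terms add up to [(|a+b| + |a-b|)/2 = max(|a|,|b|)]. *)
by case: (ger0P a); case: (ger0P b); case: (ger0P (a + b)); case: (ger0P (a - b)); lra.
Qed.

(** * Growth of the sums of absolute values *)

Lemma sum_norm_eta_pow4 (R : realType) (k : nat) :
  \sum_(0 <= m < 4 ^ k) `|eta R m| <= 3 ^+ k.
Proof.
suff step n : \sum_(0 <= m < 4 * n) `|eta R m| <= 3 * \sum_(0 <= m < n) `|eta R m|.
  elim: k => [|k IHk]; first by rewrite expn0 big_nat1 eta0 normr1 expr0.
  by rewrite expnS exprS; apply: (le_trans (step _)); rewrite ler_pM2l.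
(* Summing [|eta (m+1)|] shifts the range: the end term [|eta n|] enters and [|eta 0| = 1]
   leaves. *)
suff : \sum_(0 <= m < 4 * n) `|eta R m| <=
    3 * \sum_(0 <= m < n) `|eta R m| + (`|eta R n| - 1).
  by have := norm_eta_le1 R n; lra.
elim: n => [|n IHn]; first by rewrite muln0 !big_geq // eta0 normr1; lra.
have -> : (4 * n.+1 = (4 * n).+4)%N by lia.
rewrite !big_nat_recr //=; have := norm_eta_block R n; lra.
Qed.

Lemma sum_norm_eta_le (R : realType) (N : nat) : (0 < N)%N ->
  \sum_(0 <= m < N) `|eta R m| <= 3 * N%:R `^ (ln 3 / ln 4).
Proof.
move=> N0; set k := trunc_log 4 N.
have ln4 : 0 < ln 4 :> R by rewrite ln_gt0 // ltr1n.
have ln3 : 0 < ln 3 :> R by rewrite ln_gt0 // ltr1n.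
have pow3 : 3 ^+ k = (4 ^ k)%:R `^ (ln 3 / ln 4) :> R.
  rewrite /powR pnatr_eq0 expn_eq0 /= natrX lnXn //.
  by rewrite mulrnAr divfK ?gt_eqF // -[_ *+ k]mulr_natl expRM_natl lnK ?posrE.
(* Since [4^k <= N < 4^(k+1)], rounding [N] up to the next power of 4 costs the factor 3. *)
apply: (@le_trans _ _ (3 ^+ k.+1)).
  apply: (le_trans _ (sum_norm_eta_pow4 R k.+1)).
  rewrite [leRHS](big_cat_nat (n := N)) //=; last exact/ltnW/trunc_log_ltn.
  by rewrite lerDl sumr_ge0.
rewrite exprS ler_pM2l // pow3 ge0_ler_powR ?nnegrE //.
  by rewrite divr_ge0 // ltW.
by rewrite ler_nat trunc_logP.
Qed.

Theorem theorem3p5 (R : realType) (alpha : R) (halpha : ln 3 / ln 4 < alpha) :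
  ((N%:R `^ alpha)^-1 * \sum_(0 <= m < N) `|eta R m|) @[N --> \oo] --> (0 : R).
Proof.
set beta := ln 3 / ln 4 in halpha.
have g0 : 0 < alpha - beta by rewrite subr_gt0.
apply/cvgrPdist_le => e e0; near=> N.
have N0 : (0 < N)%N by near: N; exact: nbhs_infty_gt.
(* Solves [3 N^beta <= e N^alpha] for [N]. *)
have hN : (3 / e) `^ (alpha - beta)^-1 <= N%:R by near: N; exact: nbhs_infty_ger.
have large : 3 / e <= N%:R `^ (alpha - beta).
  have e3 : 0 <= 3 / e by rewrite divr_ge0 // ltW.
  rewrite -[leLHS]powRr1 // -[X in _ `^ X](mulVf (lt0r_neq0 g0)) powRrM.
  by apply: ge0_ler_powR; rewrite ?nnegrE ?powR_ge0 // ltW.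
rewrite sub0r normrN ger0_norm; last first.
  by rewrite mulr_ge0 ?invr_ge0 ?powR_ge0 // sumr_ge0.
have NR : 0 < N%:R :> R by rewrite ltr0n.
rewrite mulrC ler_pdivrMr ?powR_gt0 //; apply: (le_trans (sum_norm_eta_le R N N0)).
rewrite -[alpha](subrK beta) powRD ?(gt_eqF NR) ?implybT // mulrA.
by rewrite ler_pM2r ?powR_gt0 // mulrC -ler_pdivrMr.
Unshelve. all: by end_near. Qed.
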